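(* Let $r=\langle L\leftarrow K\rightarrow R\rangle$ be a rule and let $g:L\to G$ be an injective graph morphism into a graph $G$ (all over the label alphabet $\mathcal{L}$). Then there exist graphs $D,H$ and graph morphisms $d:K\to D$, $c:D\to G$, $c':D\to H$, $h:R\to H$ such that the two squares ($K\to L\xrightarrow{g}G = K\xrightarrow{d}D\xrightarrow{c}G$ and $K\to R\xrightarrow{h}H=K\xrightarrow{d}D\xrightarrow{c'}H$) are both natural pushouts (a natural double-pushout diagram) if and only if $g$ satisfies the dangling condition. In this case $D$ and $H$ are unique up to isomorphism, and (for $G$ a TLRG) they coincide up to isomorphism with the intermediate graph and result graph produced by the rule-application construction. Moreover, if $G\Rightarrow_r H$ (i.e. such a natural double-pushout diagram exists with $G$ and $H$ as its bottom-left and bottom-right graphs), then $G$ is a TLRG if and only if $H$ is a TLRG.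
   Context: Fix a label alphabet $\mathcal{L}=(\mathcal{L}_V,\mathcal{L}_E)$ of finite sets. A graph over $\mathcal{L}$ is a tuple $G=(V,E,s,t,l,m,p)$ where $V,E$ are finite sets, $s,t:E\to V$ are total source and target functions, $l:V\to\mathcal{L}_V$ is a partial node-labelling function, $m:E\to\mathcal{L}_E$ is a total edge-labelling function, and $p:V\to\{0,1\}$ is a partial rootedness function ($p(v)=1$: root node; $p(v)=0$: non-root). $G$ is a TLRG (totally labelled, totally rooted graph) if $l$ and $p$ are total. A graph morphism $g:G\to H$ is a pair of functions $g_V:V_G\to V_H$, $g_E:E_G\to E_H$ with $g_V(s_G(e))=s_H(g_E(e))$, $g_V(t_G(e))=t_H(g_E(e))$, $m_G(e)=m_H(g_E(e))$ for all edges $e$, $l_G(v)=l_H(g_V(v))$ whenever $l_G(v)$ is defined, and $p_G(v)=p_H(g_V(v))$ whenever $p_G(v)$ is defined. It is injective/surjective if both components are; an isomorphism if bijective with inverse a morphism. $K$ is a subgraph of $G$ (inclusion $K\hookrightarrow G$) iff $V_K\subseteq V_G$, $E_K\subseteq E_G$, $s_K,t_K,m_K$ are restrictions of $s_G,t_G,m_G$, and $l_K\subseteq l_G$, $p_K\subseteq p_G$ as sets of pairs. Graphs and morphisms form a category; a pushout (resp. pullback) is meant in this category, and a natural pushout is a commuting square that is both a pushout and a pullback. A rule $r=\langle L\leftarrow K\rightarrow R\rangle$ consists of TLRGs $L,R$ and a graph $K$ which is a subgraph of both $L$ and $R$, with the two inclusions. An injective morphism $g:L\to G$ satisfies the dangling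 condition iff no edge of $G$ outside $g(L)$ is incident to a node in $g(V_L\setminus V_K)$. Rule application to a TLRG $G$ via such $g$: (1) delete the images of the nodes and edges of $L$ not in $K$; for each $v\in V_K$ with $l_K(v)$ undefined make $g_V(v)$ unlabelled, and for each $v\in V_K$ with $p_K(v)$ undefined make the rootedness of $g_V(v)$ undefined; this gives the intermediate graph $D$. (2) Add disjointly the nodes and edges of $R$ not in $K$ with their labels and rootedness (edges attached to $g_V$-images of $K$-nodes or to the new nodes); for each $v\in V_K$ with $l_K(v)$ undefined label $g_V(v)$ by $l_R(v)$, and for each $v\in V_K$ with $p_K(v)$ undefined give $g_V(v)$ rootedness $p_R(v)$; this gives the result graph $H$. *)

(* Defs.v *)
From mathcomp Require Import all_boot.

Set Implicit Arguments.
Unset Strict Implicit.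
Unset Printing Implicit Defensive.

(* Partial functions are [option]-valued: [None] means undefined.  In [root],
   [Some true] is a root node and [Some false] a non-root node. *)
Record graph (LV LE : finType) := Graph {
  vert : finType;
  edge : finType;
  src : edge -> vert;
  tgt : edge -> vert;
  vlab : vert -> option LV;
  elab : edge -> LE;
  root : vert -> option bool
}.

Definition TLRG (LV LE : finType) (G : graph LV LE) : Prop :=
  (forall v : vert G, isSome (vlab v)) /\ (forall v : vert G, isSome (root v)).

Record hom (LV LE : finType) (G H : graph LV LE) := Hom {
  homV : vert G -> vert H;
  homE : edge G -> edge H;
  hom_src : forall e, homV (src e) = src (homE e);
  hom_tgt : forall e, homV (tgt e) = tgt (homE e);
  hom_elab : forall e, elab e = elab (homE e);
  hom_vlab : forall v, isSome (vlab v) -> vlab v = vlab (homV v);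
  hom_root : forall v, isSome (root v) -> root v = root (homV v)
}.

(* Morphisms carry proofs, so they are compared through their two underlying
   functions. *)
Definition hom_eq (LV LE : finType) (G H : graph LV LE) (f g : hom G H) : Prop :=
  homV f =1 homV g /\ homE f =1 homE g.

Definition hom_inj (LV LE : finType) (G H : graph LV LE) (f : hom G H) : Prop :=
  injective (homV f) /\ injective (homE f).

Definition hom_id (LV LE : finType) (G : graph LV LE) : hom G G :=
  {| homV := id; homE := id;
     hom_src := fun=> erefl; hom_tgt := fun=> erefl; hom_elab := fun=> erefl;
     hom_vlab := fun _ _ => erefl; hom_root := fun _ _ => erefl |}.

Definition hom_comp (LV LE : finType) (F G H : graph LV LE)
    (g : hom G H) (f : hom F G) : hom F H.
Proof.
refine {| homV := homV g \o homV f; homE := homE g \o homE f |}.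
- by move=> e /=; rewrite !hom_src.
- by move=> e /=; rewrite !hom_tgt.
- by move=> e /=; rewrite -!hom_elab.
- by move=> v Hv /=; rewrite (hom_vlab f Hv) (hom_vlab g) // -(hom_vlab f Hv).
- by move=> v Hv /=; rewrite (hom_root f Hv) (hom_root g) // -(hom_root f Hv).
Defined.

Definition iso (LV LE : finType) (G H : graph LV LE) : Prop :=
  exists (f : hom G H) (f' : hom H G),
    hom_eq (hom_comp f' f) (hom_id G) /\ hom_eq (hom_comp f f') (hom_id H).

(* In the next four definitions the square is

       A --f--> B
       |        |
       g        h
       v        v
       C --k--> P
*)
Definition commutes (LV LE : finType) (A B C P : graph LV LE)
    (f : hom A B) (g : hom A C) (h : hom B P) (k : hom C P) : Prop :=
  hom_eq (hom_comp h f) (hom_comp k g).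

Definition is_pushout (LV LE : finType) (A B C P : graph LV LE)
    (f : hom A B) (g : hom A C) (h : hom B P) (k : hom C P) : Prop :=
  commutes f g h k /\
  forall (X : graph LV LE) (x : hom B X) (y : hom C X), commutes f g x y ->
    exists u : hom P X,
      (hom_eq (hom_comp u h) x /\ hom_eq (hom_comp u k) y) /\
      forall u' : hom P X,
        hom_eq (hom_comp u' h) x -> hom_eq (hom_comp u' k) y -> hom_eq u' u.

Definition is_pullback (LV LE : finType) (A B C P : graph LV LE)
    (f : hom A B) (g : hom A C) (h : hom B P) (k : hom C P) : Prop :=
  commutes f g h k /\
  forall (X : graph LV LE) (x : hom X B) (y : hom X C), commutes x y h k ->
    exists u : hom X A,
      (hom_eq (hom_comp f u) x /\ hom_eq (hom_comp g u) y) /\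
      forall u' : hom X A,
        hom_eq (hom_comp f u') x -> hom_eq (hom_comp g u') y -> hom_eq u' u.

Definition natural_pushout (LV LE : finType) (A B C P : graph LV LE)
    (f : hom A B) (g : hom A C) (h : hom B P) (k : hom C P) : Prop :=
  is_pushout f g h k /\ is_pullback f g h k.

(* Node and edge sets are types, so "K is a subgraph of G" is rendered by an
   injective morphism K -> G: the morphism laws say that sources, targets and
   edge labels of K are restrictions of those of G, and that the graphs of the
   partial functions [vlab] and [root] of K are contained in those of G (K may
   be less defined than G).  A node or edge of G is in K iff it is in the
   codomain of the inclusion. *)
Record rule (LV LE : finType) := Rule {
  lhs : graph LV LE;
  itf : graph LV LE;
  rhs : graph LV LE;
  incL : hom itf lhs;
  incR : hom itf rhs;
  incL_inj : hom_inj incL;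
  incR_inj : hom_inj incR;
  lhs_TLRG : TLRG lhs;
  rhs_TLRG : TLRG rhs
}.

Definition dangling_condition (LV LE : finType) (r : rule LV LE)
    (G : graph LV LE) (g : hom (lhs r) G) : Prop :=
  forall e : edge G, e \notin codom (homE g) ->
  forall v : vert (lhs r), v \notin codom (homV (incL r)) ->
    src e <> homV g v /\ tgt e <> homV g v.

(*      L <-incL- K -incR-> R
        |         |         |
        g         d         h
        v         v         v
        G <--c--- D ---c'-> H      *)
Definition natural_double_pushout (LV LE : finType) (r : rule LV LE)
    (G D H : graph LV LE) (g : hom (lhs r) G) (d : hom (itf r) D)
    (c : hom D G) (c' : hom D H) (h : hom (rhs r) H) : Prop :=
  natural_pushout (incL r) d g c /\ natural_pushout (incR r) d h c'.

Definition derives (LV LE : finType) (r : rule LV LE) (G H : graph LV LE) : Prop :=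
  exists (g : hom (lhs r) G) (D : graph LV LE) (d : hom (itf r) D)
         (c : hom D G) (c' : hom D H) (h : hom (rhs r) H),
    hom_inj g /\ natural_double_pushout g d c c' h.

Definition deletedV (LV LE : finType) (r : rule LV LE) (G : graph LV LE)
    (g : hom (lhs r) G) (v : vert G) : bool :=
  [exists x : vert (lhs r), (x \notin codom (homV (incL r))) && (homV g x == v)].

Definition deletedE (LV LE : finType) (r : rule LV LE) (G : graph LV LE)
    (g : hom (lhs r) G) (e : edge G) : bool :=
  [exists x : edge (lhs r), (x \notin codom (homE (incL r))) && (homE g x == e)].

(* For g injective, the unique node k of K with undefined label (resp.
   rootedness) and image v in G, if there is one. *)
Definition relabelled_at (LV LE : finType) (r : rule LV LE) (G : graph LV LE)
    (g : hom (lhs r) G) (v : vert G) : option (vert (itf r)) :=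
  [pick k | (homV g (homV (incL r) k) == v) && (vlab k == None)].

Definition rerooted_at (LV LE : finType) (r : rule LV LE) (G : graph LV LE)
    (g : hom (lhs r) G) (v : vert G) : option (vert (itf r)) :=
  [pick k | (homV g (homV (incL r) k) == v) && (root k == None)].

Lemma keptV_itf (LV LE : finType) (r : rule LV LE) (G : graph LV LE)
    (g : hom (lhs r) G) (gi : hom_inj g) (k : vert (itf r)) :
  ~~ deletedV g (homV g (homV (incL r) k)).
Proof.
apply/existsP=> -[x /andP[xK /eqP /gi.1 xk]].
by move: xK; rewrite xk codom_f.
Qed.

Lemma keptV_endpoint (LV LE : finType) (r : rule LV LE) (G : graph LV LE)
    (g : hom (lhs r) G) (gi : hom_inj g) (dc : dangling_condition g)
    (e : edge G) :
  ~~ deletedE g e -> ~~ deletedV g (src e) /\ ~~ deletedV g (tgt e).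
Proof.
move=> eD.
have [eg|eg] := boolP (e \in codom (homE g)); last first.
  by split; apply/existsP=> -[x /andP[xK /eqP xe]];
     have [hs ht] := dc e eg x xK; [apply: hs | apply: ht].
case/codomP: eg => e' De; move: eD; rewrite De => eD.
have [/codomP[k Dk]|e'K] := boolP (e' \in codom (homE (incL r))); last first.
  by case/existsP: eD; exists e'; rewrite e'K eqxx.
by rewrite Dk -hom_src -hom_tgt -hom_src -hom_tgt; split; apply: keptV_itf.
Qed.

Definition intermediate_vert (LV LE : finType) (r : rule LV LE)
    (G : graph LV LE) (g : hom (lhs r) G) : finType :=
  {v : vert G | ~~ deletedV g v}.

Definition intermediate_edge (LV LE : finType) (r : rule LV LE)
    (G : graph LV LE) (g : hom (lhs r) G) : finType :=
  {e : edge G | ~~ deletedE g e}.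

Definition intermediate (LV LE : finType) (r : rule LV LE) (G : graph LV LE)
    (g : hom (lhs r) G) (gi : hom_inj g) (dc : dangling_condition g) :
    graph LV LE :=
  {| vert := intermediate_vert g;
     edge := intermediate_edge g;
     src := fun e => exist _ (src (val e)) (keptV_endpoint gi dc (valP e)).1;
     tgt := fun e => exist _ (tgt (val e)) (keptV_endpoint gi dc (valP e)).2;
     vlab := fun v => if relabelled_at g (val v) is Some _ then None
                      else vlab (val v);
     elab := fun e => elab (val e);
     root := fun v => if rerooted_at g (val v) is Some _ then None
                      else root (val v) |}.

Definition new_vert (LV LE : finType) (r : rule LV LE) : finType :=
  {v : vert (rhs r) | v \notin codom (homV (incR r))}.

Definition new_edge (LV LE : finType) (r : rule LV LE) : finType :=
  {e : edge (rhs r) | e \notin codom (homE (incR r))}.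

(* The node of the result graph that a node of R stands for: the image under g
   of its preimage in K if it is in K, and its own fresh copy otherwise. *)
Definition result_node (LV LE : finType) (r : rule LV LE) (G : graph LV LE)
    (g : hom (lhs r) G) (gi : hom_inj g) (v : vert (rhs r)) :
    intermediate_vert g + new_vert r :=
  match boolP (v \in codom (homV (incR r))) with
  | AltTrue vK =>
      inl (exist _ (homV g (homV (incL r) (iinv vK))) (keptV_itf gi (iinv vK)))
  | AltFalse vnK => inr (exist _ v vnK)
  end.

Definition result (LV LE : finType) (r : rule LV LE) (G : graph LV LE)
    (g : hom (lhs r) G) (gi : hom_inj g) (dc : dangling_condition g) :
    graph LV LE :=
  let D := intermediate gi dc in
  {| vert := (intermediate_vert g + new_vert r)%type;
     edge := (intermediate_edge g + new_edge r)%type;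
     src := fun e => match e with
                     | inl e => inl (@src _ _ D e)
                     | inr e => result_node gi (src (val e))
                     end;
     tgt := fun e => match e with
                     | inl e => inl (@tgt _ _ D e)
                     | inr e => result_node gi (tgt (val e))
                     end;
     vlab := fun v => match v with
                      | inl v => if relabelled_at g (val v) is Some k
                                 then vlab (homV (incR r) k)
                                 else @vlab _ _ D v
                      | inr v => vlab (val v)
                      end;
     elab := fun e => match e with
                      | inl e => @elab _ _ D e
                      | inr e => elab (val e)
                      end;
     root := fun v => match v with
                      | inl v => if rerooted_at g (val v) is Some k
                                 then root (homV (incR r) k)
                                 else @root _ _ D v
                      | inr v => root (val v)
                      end |}.

(* Main.v *)
From mathcomp Require Import all_boot.
Require Import Defs.

Set Implicit Arguments.
Unset Strict Implicit.
Unset Printing Implicit Defensive.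

(** A square of graphs whose span legs are injective is a pushout exactly when
    it is, concretely, a gluing: two graphs overlapping precisely in [A] and
    jointly covering [P], every label or rootedness value of [P] being inherited
    from one of them.  It is moreover a pullback exactly when a node of [A] has a
    label (rootedness) as soon as both its images do.  That pushouts are
    gluings is seen by comparison with an explicitly constructed gluing.  Once
    natural pushouts are described concretely, [D] is forced to be the part of
    [G] outside the image of [L] minus [K], with labels and rootedness forced as
    well, and [H] is then unique as a pushout. *)

(** * Gluing of sets and partial labellings *)

(** For injective [f] and [g], the concrete form of a square of finite sets that is both a pushout
    and a pullback. The next two lemmas extract the mediating functions. *)
Record set_gluing (A B C P : finType)
    (f : A -> B) (g : A -> C) (h : B -> P) (k : C -> P) : Prop := SetGluing {
  gluing_comm : forall a, h (f a) = k (g a);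
  gluing_injl : injective h;
  gluing_injr : injective k;
  gluing_cover : forall p, (exists b, h b = p) \/ (exists c, k c = p);
  gluing_overlap : forall b c, h b = k c -> exists a, b = f a /\ c = g a
}.

(** The value at [p] can be read off any preimage: each side has at most one by injectivity, and
    preimages on both sides come from a common point of [A], where [x] and [y] agree. Finiteness
    turns this pointwise existence into a function. *)
Lemma set_gluing_factor (A B C P X : finType)
    (f : A -> B) (g : A -> C) (h : B -> P) (k : C -> P)
    (x : B -> X) (y : C -> X) :
  set_gluing f g h k -> x \o f =1 y \o g ->
  exists u : P -> X, u \o h =1 x /\ u \o k =1 y.
Proof.
move=> sq xy.
have /fin_all_exists[u uP] : forall p, exists z : X,
    (forall b, h b = p -> z = x b) /\ (forall c, k c = p -> z = y c).
  move=> p; case: (gluing_cover sq p) => [[b <-]|[c <-]].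
    exists (x b); split=> [b' /(gluing_injl sq) -> // | c /esym].
    by case/(gluing_overlap sq) => a [-> ->]; apply: xy.
  exists (y c); split=> [b | c' /(gluing_injr sq) -> //].
  by case/(gluing_overlap sq) => a [-> ->]; apply/esym/xy.
by exists u; split=> [b | c] /=; [apply: (uP _).1 | apply: (uP _).2].
Qed.

Lemma set_gluing_lift (A B C P X : finType)
    (f : A -> B) (g : A -> C) (h : B -> P) (k : C -> P)
    (x : X -> B) (y : X -> C) :
  set_gluing f g h k -> h \o x =1 k \o y ->
  exists u : X -> A, f \o u =1 x /\ g \o u =1 y.
Proof.
move=> sq xy.
have /fin_all_exists[u uP] : forall z, exists a, x z = f a /\ y z = g a.
  by move=> z; apply: (gluing_overlap sq); apply: xy.
by exists u; split=> z /=; case: (uP z).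
Qed.

(** * The explicit gluing of two finite sets *)

Section SetGlue.
Variables (A B C : finType) (f : A -> B) (g : A -> C).

(** Adding to [C] only the points of [B] outside the image of [f] avoids forming a quotient of the
    disjoint union. The shape is that of [result_node]. *)
Definition glue_inl (b : B) : C + {b : B | b \notin codom f} :=
  match boolP (b \in codom f) with
  | AltTrue bA => inl (g (iinv bA))
  | AltFalse bnA => inr (exist _ b bnA)
  end.

Hypothesis f_inj : injective f.

Lemma glue_inl_im a : glue_inl (f a) = inl (g a).
Proof.
rewrite /glue_inl; case: {-}_ / boolP => [fA|fnA]; last by case/negP: (fnA); apply: codom_f.
by congr (inl (g _)); apply: f_inj; rewrite f_iinv.
Qed.

Lemma glue_inl_new (b : {b : B | b \notin codom f}) : glue_inl (val b) = inr b.
Proof.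
case: b => b bnA; rewrite /glue_inl /=; case: {-}_ / boolP => [bA|bnA'].
  by case/negP: (bnA).
by congr (inr _); apply: val_inj.
Qed.

Variant glue_inl_spec b : C + {b : B | b \notin codom f} -> Prop :=
  | GlueOld a of b = f a : glue_inl_spec b (inl (g a))
  | GlueNew b' of b = val b' : glue_inl_spec b (inr b').

Lemma glue_inlP b : glue_inl_spec b (glue_inl b).
Proof.
have [/codomP[a ->]|bnA] := boolP (b \in codom f).
  by rewrite glue_inl_im; constructor.
by rewrite -[b]/(val (exist (fun b => b \notin codom f) b bnA)) glue_inl_new;
   constructor.
Qed.

Lemma set_glueP : injective g -> set_gluing f g glue_inl inl.
Proof.
move=> g_inj; split.
- exact: glue_inl_im.
- move=> b b'; case: glue_inlP => [a|c] ->; case: glue_inlP => [a'|c'] -> //.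
    by case=> /g_inj ->.
  by case=> ->.
- by move=> c c' [].
- move=> [c|b]; first by right; exists c.
  by left; exists (val b); apply: glue_inl_new.
- by move=> b c; case: glue_inlP => // a -> [<-]; exists a.
Qed.
End SetGlue.

(** * Partial labellings, treated once for node labels and rootedness *)

Section PartialLabels.
Variable T : Type.

Definition lab_preserved (A B : Type) (lA : A -> option T) (lB : B -> option T)
  (f : A -> B) := forall v, isSome (lA v) -> lA v = lB (f v).

(** The labelling part of being a pushout, as [lab_reflected] below is that of being a pullback.
    Only definedness is recorded: the values agree once [h] and [k] preserve labels. *)
Definition lab_covered (B C P : Type) (lB : B -> option T) (lC : C -> option T)
    (lP : P -> option T) (h : B -> P) (k : C -> P) :=
  forall v, isSome (lP v) ->
    (exists b, h b = v /\ isSome (lB b)) \/ (exists c, k c = v /\ isSome (lC c)).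

Definition lab_reflected (A B C : Type) (lA : A -> option T)
    (lB : B -> option T) (lC : C -> option T) (f : A -> B) (g : A -> C) :=
  forall a, isSome (lB (f a)) -> isSome (lC (g a)) -> isSome (lA a).

Lemma lab_preserved_isSome (A B : Type) (lA : A -> option T)
    (lB : B -> option T) (f : A -> B) v :
  lab_preserved lA lB f -> isSome (lA v) -> isSome (lB (f v)).
Proof. by move=> pf lv; rewrite -(pf v lv). Qed.

Lemma lab_preserved_factor (B C P X : Type) (lB : B -> option T)
    (lC : C -> option T) (lP : P -> option T) (lX : X -> option T)
    (h : B -> P) (k : C -> P) (u : P -> X) :
  lab_preserved lB lP h -> lab_preserved lC lP k -> lab_covered lB lC lP h k ->
  lab_preserved lB lX (u \o h) -> lab_preserved lC lX (u \o k) ->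
  lab_preserved lP lX u.
Proof.
move=> ph pk cov px py v /cov[[b [<- lb]]|[c [<- lc]]].
  by rewrite -ph // px.
by rewrite -pk // py.
Qed.

Lemma lab_preserved_lift (A B C X : Type) (lA : A -> option T)
    (lB : B -> option T) (lC : C -> option T) (lX : X -> option T)
    (f : A -> B) (g : A -> C) (u : X -> A) :
  lab_preserved lA lB f -> lab_reflected lA lB lC f g ->
  lab_preserved lX lB (f \o u) -> lab_preserved lX lC (g \o u) ->
  lab_preserved lX lA u.
Proof.
move=> pf refl px py v lv.
rewrite px // pf //; apply: refl.
- exact: (lab_preserved_isSome px).
- exact: (lab_preserved_isSome py).
Qed.

(** The label of [x] reaches [P], where the second square traces it to [C2] or to [B]. In the first
    case its source is [phi x] by injectivity of [k2]. In the second, [x] is [g1 a]; reflection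
    makes [a] itself labelled, and [g1] and [g2] carry that label to [x] and [phi x]. *)
Lemma lab_preserved_complement (A B C1 C2 P : finType) (lA : A -> option T)
    (lB : B -> option T) (l1 : C1 -> option T) (l2 : C2 -> option T)
    (lP : P -> option T) (f : A -> B) (h : B -> P)
    (g1 : A -> C1) (k1 : C1 -> P) (g2 : A -> C2) (k2 : C2 -> P)
    (phi : C1 -> C2) :
  set_gluing f g1 h k1 -> set_gluing f g2 h k2 -> k2 \o phi =1 k1 ->
  lab_preserved l1 lP k1 -> lab_preserved l2 lP k2 ->
  lab_preserved lA l1 g1 -> lab_preserved lA l2 g2 ->
  lab_reflected lA lB l1 f g1 -> lab_covered lB l2 lP h k2 ->
  lab_preserved l1 l2 phi.
Proof.
move=> sq1 sq2 ephi pk1 pk2 pg1 pg2 refl cov x lx.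
have ex : k1 x = k2 (phi x) by rewrite -[RHS]/((k2 \o phi) x) ephi.
have [[b [hb lb]]|[y [ky ly]]] := cov _ (lab_preserved_isSome pk1 lx).
  have [a [eb exa]] := gluing_overlap sq1 hb; move: lb lx ex; rewrite eb exa.
  move=> lb lx; rewrite -(gluing_comm sq1) (gluing_comm sq2).
  move/(gluing_injr sq2) => <-.
  by have la := refl a lb lx; rewrite -pg1 // -pg2.
have eyx : y = phi x by apply: (gluing_injr sq2); rewrite ky.
by rewrite pk1 // -eyx pk2 // ky.
Qed.

(** Only points [k2 c] need care. The label of [k1 c] comes either from [c], and then [k2]
    transports it, or from [B1]; in the latter case [c] is some [g a], so [k2 c] is [h2 (f2 a)],
    labelled because [B2] is total. *)
Lemma lab_total_transfer (A B1 B2 C P1 P2 : finType)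
    (l1 : P1 -> option T) (l2 : P2 -> option T) (lC : C -> option T)
    (lB1 : B1 -> option T) (lB2 : B2 -> option T)
    (f1 : A -> B1) (f2 : A -> B2) (g : A -> C) (h1 : B1 -> P1) (h2 : B2 -> P2)
    (k1 : C -> P1) (k2 : C -> P2) :
  set_gluing f1 g h1 k1 -> set_gluing f2 g h2 k2 ->
  lab_covered lB1 lC l1 h1 k1 ->
  lab_preserved lB2 l2 h2 -> lab_preserved lC l2 k2 ->
  (forall b, isSome (lB2 b)) -> (forall p, isSome (l1 p)) ->
  forall p, isSome (l2 p).
Proof.
move=> sq1 sq2 cov ph pk tB tP p.
have th b : isSome (l2 (h2 b)) by apply: (lab_preserved_isSome ph).
have [[b <- //]|[c <-]] := gluing_cover sq2 p.
have [[b [hb _]]|[c' [/(gluing_injr sq1) -> lc]]] := cov _ (tP (k1 c)).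
  by have [a [_ ->]] := gluing_overlap sq1 hb; rewrite -(gluing_comm sq2).
exact: (lab_preserved_isSome pk).
Qed.

Section GlueLabels.
Variables (A B C : finType) (f : A -> B) (g : A -> C).
Variables (lB : B -> option T) (lC : C -> option T).

(** A point of [C] without a label inherits that of the point of [B] glued to it. When both carry a
    label, [compat] makes the priority given to [C] harmless. *)
Definition glue_lab (p : C + {b : B | b \notin codom f}) : option T :=
  match p with
  | inl c => if lC c is Some t then Some t
             else if [pick a | g a == c] is Some a then lB (f a) else None
  | inr b => lB (val b)
  end.

Hypotheses (f_inj : injective f) (g_inj : injective g).
Hypothesis compat :
  forall a, isSome (lB (f a)) -> isSome (lC (g a)) -> lB (f a) = lC (g a).

Lemma glue_lab_inl : lab_preserved lB glue_lab (glue_inl f g).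
Proof.
move=> b; case: glue_inlP => // [a|b' -> //]; move=> -> lb /=.
case lc: (lC (g a)) => [t|]; first by rewrite -lc compat // lc.
by case: pickP => [a' /eqP/g_inj -> // | /(_ a)]; rewrite eqxx.
Qed.

Lemma glue_lab_inr : lab_preserved lC glue_lab inl.
Proof. by move=> c /=; case: (lC c). Qed.

Lemma glue_lab_covered : lab_covered lB lC glue_lab (glue_inl f g) inl.
Proof.
move=> [c|b] /=; last by left; exists (val b); rewrite glue_inl_new.
case lc: (lC c) => [t|]; first by right; exists c; rewrite lc.
by case: pickP => // a /eqP <- lb; left; exists (f a); rewrite glue_inl_im.
Qed.
End GlueLabels.
End PartialLabels.

(** * Natural pushouts of graphs as gluings *)

Section Gluing.
Variables (LV LE : finType) (A B C P : graph LV LE).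
Variables (f : hom A B) (g : hom A C) (h : hom B P) (k : hom C P).

Record gluing : Prop := Gluing {
  gluingV : set_gluing (homV f) (homV g) (homV h) (homV k);
  gluingE : set_gluing (homE f) (homE g) (homE h) (homE k);
  gluing_vlab : lab_covered (@vlab _ _ B) (@vlab _ _ C) (@vlab _ _ P)
                            (homV h) (homV k);
  gluing_root : lab_covered (@root _ _ B) (@root _ _ C) (@root _ _ P)
                            (homV h) (homV k)
}.

Definition reflecting : Prop :=
  lab_reflected (@vlab _ _ A) (@vlab _ _ B) (@vlab _ _ C) (homV f) (homV g) /\
  lab_reflected (@root _ _ A) (@root _ _ B) (@root _ _ C) (homV f) (homV g).

Lemma gluing_commutes : gluing -> commutes f g h k.
Proof.
by move=> sq; split=> a /=;
   [apply: (gluing_comm (gluingV sq)) | apply: (gluing_comm (gluingE sq))].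
Qed.

Lemma gluing_pushout : gluing -> is_pushout f g h k.
Proof.
move=> sq; split; first exact: gluing_commutes.
move=> X x y [xyV xyE].
have [uV [uVh uVk]] := set_gluing_factor (gluingV sq) xyV.
have [uE [uEh uEk]] := set_gluing_factor (gluingE sq) xyE.
have uhV b : uV (homV h b) = homV x b := uVh b.
have ukV c : uV (homV k c) = homV y c := uVk c.
have uhE b : uE (homE h b) = homE x b := uEh b.
have ukE c : uE (homE k c) = homE y c := uEk c.
have u_src e : uV (src e) = src (uE e).
  by have [[b <-]|[c <-]] := gluing_cover (gluingE sq) e;
     rewrite -hom_src (uhV, ukV) (uhE, ukE) hom_src.
have u_tgt e : uV (tgt e) = tgt (uE e).
  by have [[b <-]|[c <-]] := gluing_cover (gluingE sq) e;
     rewrite -hom_tgt (uhV, ukV) (uhE, ukE) hom_tgt.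
have u_elab e : elab e = elab (uE e).
  by have [[b <-]|[c <-]] := gluing_cover (gluingE sq) e;
     rewrite -hom_elab (uhE, ukE) -hom_elab.
have u_vlab : lab_preserved (@vlab _ _ P) (@vlab _ _ X) uV.
  apply: (lab_preserved_factor _ _ (gluing_vlab sq)) => v lv.
  - exact: hom_vlab.
  - exact: hom_vlab.
  - by rewrite /= uhV; apply: hom_vlab.
  - by rewrite /= ukV; apply: hom_vlab.
have u_root : lab_preserved (@root _ _ P) (@root _ _ X) uV.
  apply: (lab_preserved_factor _ _ (gluing_root sq)) => v lv.
  - exact: hom_root.
  - exact: hom_root.
  - by rewrite /= uhV; apply: hom_root.
  - by rewrite /= ukV; apply: hom_root.
exists (Hom u_src u_tgt u_elab u_vlab u_root); split=> // u' [hV hE] [kV kE].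
split=> p /=.
  have [[b <-]|[c <-]] := gluing_cover (gluingV sq) p.
    by rewrite uhV -hV.
  by rewrite ukV -kV.
have [[b <-]|[c <-]] := gluing_cover (gluingE sq) p.
  by rewrite uhE -hE.
by rewrite ukE -kE.
Qed.

(** The lifts on nodes and edges come from the overlaps; incidence, edge labels and uniqueness are
    checked after applying [f], which is injective on nodes and edges. *)
Lemma gluing_pullback :
  hom_inj f -> gluing -> reflecting -> is_pullback f g h k.
Proof.
move=> [fiV fiE] sq [rl rr]; split; first exact: gluing_commutes.
move=> X x y [xyV xyE].
have [uV [uVf uVg]] := set_gluing_lift (gluingV sq) xyV.
have [uE [uEf uEg]] := set_gluing_lift (gluingE sq) xyE.
have fuV z : homV f (uV z) = homV x z := uVf z.
have fuE z : homE f (uE z) = homE x z := uEf z.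
have u_src e : uV (src e) = src (uE e).
  by apply: fiV; rewrite fuV hom_src hom_src fuE.
have u_tgt e : uV (tgt e) = tgt (uE e).
  by apply: fiV; rewrite fuV hom_tgt hom_tgt fuE.
have u_elab e : elab e = elab (uE e).
  by rewrite (hom_elab f) fuE -hom_elab.
have u_vlab : lab_preserved (@vlab _ _ X) (@vlab _ _ A) uV.
  apply: (lab_preserved_lift (@hom_vlab _ _ _ _ f) rl) => v lv.
    by rewrite uVf; apply: hom_vlab.
  by rewrite uVg; apply: hom_vlab.
have u_root : lab_preserved (@root _ _ X) (@root _ _ A) uV.
  apply: (lab_preserved_lift (@hom_root _ _ _ _ f) rr) => v lv.
    by rewrite uVf; apply: hom_root.
  by rewrite uVg; apply: hom_root.
exists (Hom u_src u_tgt u_elab u_vlab u_root); split=> // u' [hV hE] _.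
split=> p /=.
  by apply: fiV; rewrite fuV -hV.
by apply: fiE; rewrite fuE -hE.
Qed.

Lemma gluing_natural_pushout :
  hom_inj f -> gluing -> reflecting -> natural_pushout f g h k.
Proof.
by move=> fi sq rf; split; [apply: gluing_pushout | apply: gluing_pullback].
Qed.

(* Test object for the pullback property: one node carrying the given values,
   no edge. *)
Definition point_graph (l : option LV) (p : option bool) : graph LV LE :=
  {| vert := unit; edge := void;
     src := fun e => match e with end; tgt := fun e => match e with end;
     vlab := fun=> l; elab := fun e => match e with end; root := fun=> p |}.

Lemma point_hom (l : option LV) (p : option bool) (X : graph LV LE)
    (v : vert X) :
  (isSome l -> l = vlab v) -> (isSome p -> p = root v) ->
  exists x : hom (point_graph l p) X, homV x tt = v.
Proof.
move=> lv pv; pose xE (e : edge (point_graph l p)) : edge X := match e with end.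
have x_src e : v = src (xE e) by case: e.
have x_tgt e : v = tgt (xE e) by case: e.
have x_elab e : elab e = elab (xE e) by case: e.
by exists (@Hom _ _ (point_graph l p) X (fun=> v) xE x_src x_tgt x_elab
             (fun=> lv) (fun=> pv)).
Qed.

(** The point graph maps to the two images of [a], forming a cone. Its mediating morphism must hit
    [a], by injectivity of [f], and preserves the values carried by the point. *)
Lemma pullback_point l p (a : vert A) : hom_inj f -> is_pullback f g h k ->
  (isSome l -> l = vlab (homV f a)) -> (isSome p -> p = root (homV f a)) ->
  (isSome l -> l = vlab (homV g a)) -> (isSome p -> p = root (homV g a)) ->
  (isSome l -> isSome (vlab a)) /\ (isSome p -> isSome (root a)).
Proof.
move=> [fiV _] [[cV _] pb] lf pf lg pg.
have [x xa] := point_hom lf pf; have [y ya] := point_hom lg pg.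
have [|u [[[fu _] _] _]] := pb (point_graph l p) x y.
  by split=> [[]|[]] /=; rewrite xa ya; apply: cV.
have ua : homV u tt = a by apply: fiV; rewrite -xa -fu.
by split=> s; rewrite -ua; [rewrite -(hom_vlab u) | rewrite -(hom_root u)].
Qed.

Lemma commutes_vlab (a : vert A) : commutes f g h k ->
  isSome (vlab (homV f a)) -> isSome (vlab (homV g a)) ->
  vlab (homV f a) = vlab (homV g a).
Proof.
by move=> [cV _] sf sg; rewrite (hom_vlab h sf) (hom_vlab k sg); congr vlab;
   apply: cV.
Qed.

Lemma commutes_root (a : vert A) : commutes f g h k ->
  isSome (root (homV f a)) -> isSome (root (homV g a)) ->
  root (homV f a) = root (homV g a).
Proof.
by move=> [cV _] sf sg; rewrite (hom_root h sf) (hom_root k sg); congr root;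
   apply: cV.
Qed.

Lemma pullback_reflecting : hom_inj f -> is_pullback f g h k -> reflecting.
Proof.
move=> fi pb; have cm := pb.1; split=> a sf sg.
  (* The test point carries only a label here and only a rootedness value below, so the two
     attributes are tested independently. *)
  by apply: (pullback_point (l := vlab (homV f a)) (p := None) fi pb _ _ _ _).1
    => // _; apply: commutes_vlab.
by apply: (pullback_point (l := None) (p := root (homV f a)) fi pb _ _ _ _).2
  => // _; apply: commutes_root.
Qed.
End Gluing.

(** * The explicit gluing of graphs, and its comparison with pushouts *)

Section GlueGraph.
Variables (LV LE : finType) (A B C : graph LV LE) (f : hom A B) (g : hom A C).

Definition glue_graph : graph LV LE :=
  {| vert := (vert C + {v : vert B | v \notin codom (homV f)})%type;
     edge := (edge C + {e : edge B | e \notin codom (homE f)})%type;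
     src := fun e => match e with
                     | inl e => inl (src e)
                     | inr e => glue_inl (homV f) (homV g) (src (val e))
                     end;
     tgt := fun e => match e with
                     | inl e => inl (tgt e)
                     | inr e => glue_inl (homV f) (homV g) (tgt (val e))
                     end;
     vlab := glue_lab (homV g) (@vlab _ _ B) (@vlab _ _ C);
     elab := fun e => match e with inl e => elab e | inr e => elab (val e) end;
     root := glue_lab (homV g) (@root _ _ B) (@root _ _ C) |}.

(** The cocone into [X] guarantees that labels and rootedness defined at both [f a] and [g a] agree;
    otherwise the span would have no cocone at all. *)
Lemma glue_graphP (X : graph LV LE) (x : hom B X) (y : hom C X) :
  hom_inj f -> hom_inj g -> commutes f g x y ->
  exists (h : hom B glue_graph) (k : hom C glue_graph), gluing f g h k.
Proof.
move=> [fiV fiE] [giV giE] cm.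
pose hV : vert B -> vert glue_graph := glue_inl (homV f) (homV g).
pose hE : edge B -> edge glue_graph := glue_inl (homE f) (homE g).
have h_src e : hV (src e) = src (hE e).
  rewrite /hE; case: glue_inlP => // [a|e'] -> //=.
  by rewrite -!hom_src /hV glue_inl_im.
have h_tgt e : hV (tgt e) = tgt (hE e).
  rewrite /hE; case: glue_inlP => // [a|e'] -> //=.
  by rewrite -!hom_tgt /hV glue_inl_im.
have h_elab e : elab e = elab (hE e).
  by rewrite /hE; case: glue_inlP => // [a|e'] -> //=; rewrite -!hom_elab.
have lc a := @commutes_vlab _ _ _ _ _ _ _ _ _ _ a cm.
have rc a := @commutes_root _ _ _ _ _ _ _ _ _ _ a cm.
pose h := @Hom _ _ B glue_graph hV hE h_src h_tgt h_elab
  (glue_lab_inl fiV giV lc) (glue_lab_inl fiV giV rc).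
pose k := @Hom _ _ C glue_graph inl inl (fun=> erefl) (fun=> erefl)
  (fun=> erefl) (@glue_lab_inr _ _ _ _ _ _ _ _) (@glue_lab_inr _ _ _ _ _ _ _ _).
exists h, k; split; try exact: set_glueP.
- exact: glue_lab_covered.
- exact: glue_lab_covered.
Qed.
End GlueGraph.

Lemma pushout_endo_id (LV LE : finType) (A B C P : graph LV LE)
    (f : hom A B) (g : hom A C) (h : hom B P) (k : hom C P) (u : hom P P) :
  is_pushout f g h k -> hom_eq (hom_comp u h) h -> hom_eq (hom_comp u k) k ->
  hom_eq u (hom_id P).
Proof.
move=> [cm po] uh uk; have [w [_ wP]] := po P h k cm.
have [wV wE] := wP u uh uk.
have [iV iE] : hom_eq (hom_id P) w by apply: wP.
by split=> z; rewrite (wV, wE) (iV, iE).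
Qed.

(** Restates an equation between morphisms as pointwise equations ready for rewriting. *)
Lemma hom_comp_eq (LV LE : finType) (F G H : graph LV LE) (f : hom F G)
    (g : hom G H) (h : hom F H) :
  hom_eq (hom_comp g f) h ->
  (forall v, homV g (homV f v) = homV h v) /\
  (forall e, homE g (homE f e) = homE h e).
Proof. by []. Qed.

(** Universality gives [u] from [P] to the explicit gluing and [w] back, with [w] after [u] the
    identity. This one retraction suffices: injectivity and overlaps are pulled back along [u],
    while coverings of points and labels are pushed forward along [w]. *)
Lemma pushout_gluing (LV LE : finType) (A B C P : graph LV LE)
    (f : hom A B) (g : hom A C) (h : hom B P) (k : hom C P) :
  hom_inj f -> hom_inj g -> is_pushout f g h k -> gluing f g h k.
Proof.
move=> fi gi po; have cm := po.1.
have [h0 [k0 sq]] := glue_graphP fi gi cm; have [cm0 po0] := gluing_pushout sq.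
have [u [[/hom_comp_eq[uhV uhE] /hom_comp_eq[ukV ukE]] _]] := po.2 _ _ _ cm0.
have [w [[/hom_comp_eq[whV whE] /hom_comp_eq[wkV wkE]] _]] := po0 _ _ _ cm.
have [wuV wuE] : (forall v, homV w (homV u v) = v) /\
                 (forall e, homE w (homE u e) = e).
  by apply: (pushout_endo_id (u := hom_comp w u) po); split=> z /=;
     rewrite (uhV, uhE, ukV, ukE) (whV, whE, wkV, wkE).
split.
- split.
  + exact: cm.1.
  + move=> b b' e; apply: (gluing_injl (gluingV sq)).
    by rewrite -!uhV e.
  + move=> c c' e; apply: (gluing_injr (gluingV sq)).
    by rewrite -!ukV e.
  + move=> p; rewrite -(wuV p).
    case: (gluing_cover (gluingV sq) (homV u p)) => [[b <-]|[c <-]].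
      by left; exists b; apply/esym/whV.
    by right; exists c; apply/esym/wkV.
  + move=> b c e; apply: (gluing_overlap (gluingV sq)).
    by rewrite -uhV -ukV e.
- split.
  + exact: cm.2.
  + move=> b b' e; apply: (gluing_injl (gluingE sq)).
    by rewrite -!uhE e.
  + move=> c c' e; apply: (gluing_injr (gluingE sq)).
    by rewrite -!ukE e.
  + move=> p; rewrite -(wuE p).
    case: (gluing_cover (gluingE sq) (homE u p)) => [[b <-]|[c <-]].
      by left; exists b; apply/esym/whE.
    by right; exists c; apply/esym/wkE.
  + move=> b c e; apply: (gluing_overlap (gluingE sq)).
    by rewrite -uhE -ukE e.
- move=> p lp; have lup : isSome (vlab (homV u p)) by rewrite -hom_vlab.
  rewrite -(wuV p).
  have [[b [<- lb]]|[c [<- lc]]] := gluing_vlab sq lup.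
    by left; exists b; split=> //; apply/esym/whV.
  by right; exists c; split=> //; apply/esym/wkV.
- move=> p lp; have lup : isSome (root (homV u p)) by rewrite -hom_root.
  rewrite -(wuV p).
  have [[b [<- lb]]|[c [<- lc]]] := gluing_root sq lup.
    by left; exists b; split=> //; apply/esym/whV.
  by right; exists c; split=> //; apply/esym/wkV.
Qed.

Lemma natural_pushoutP (LV LE : finType) (A B C P : graph LV LE)
    (f : hom A B) (g : hom A C) (h : hom B P) (k : hom C P) :
  hom_inj f -> hom_inj g ->
  natural_pushout f g h k <-> gluing f g h k /\ reflecting f g.
Proof.
move=> fi gi; split=> [[po pb]|[sq rf]].
  by split; [apply: pushout_gluing | apply: pullback_reflecting pb].
exact: gluing_natural_pushout.
Qed.

(** Provides injectivity of [d], which is not part of the definition of a double pushout. *)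
Lemma commutes_inj (LV LE : finType) (A B C P : graph LV LE)
    (f : hom A B) (g : hom A C) (h : hom B P) (k : hom C P) :
  hom_inj f -> hom_inj h -> commutes f g h k -> hom_inj g.
Proof.
move=> [fV fE] [hV hE] [cV cE]; split=> a a' e.
  by apply/fV/hV; rewrite -[LHS]/(homV (hom_comp h f) a) cV /= e -[LHS]cV.
by apply/fE/hE; rewrite -[LHS]/(homE (hom_comp h f) a) cE /= e -[LHS]cE.
Qed.

(** * Uniqueness *)

(** A point of [C1] whose image in [P] comes from [B] already comes from [A], so its image also lies
    in that of [k2]. Hence [phi] is [k1] followed by the partial inverse of the injective [k2], and
    its incidence laws are checked in [P]. *)
Lemma complement_hom (LV LE : finType) (A B C1 C2 P : graph LV LE)
    (f : hom A B) (h : hom B P) (g1 : hom A C1) (k1 : hom C1 P)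
    (g2 : hom A C2) (k2 : hom C2 P) :
  gluing f g1 h k1 -> reflecting f g1 -> gluing f g2 h k2 ->
  exists phi : hom C1 C2, hom_eq (hom_comp k2 phi) k1.
Proof.
move=> sq1 [rl rr] sq2.
have set_map (A' B' C1' C2' P' : finType) (f' : A' -> B') (h' : B' -> P')
    (g1' : A' -> C1') (k1' : C1' -> P') (g2' : A' -> C2') (k2' : C2' -> P') :
    set_gluing f' g1' h' k1' -> set_gluing f' g2' h' k2' ->
    exists phi, forall x, k2' (phi x) = k1' x.
  move=> s1 s2; apply: (fin_all_exists (P := fun x y => k2' y = k1' x)) => x.
  have [[b hb]|[y <-]] := gluing_cover s2 (k1' x); last by exists y.
  have [a [_ ->]] := gluing_overlap s1 hb.
  by exists (g2' a); rewrite -(gluing_comm s2) (gluing_comm s1).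
have [pV pVP] := set_map _ _ _ _ _ _ _ _ _ _ _ (gluingV sq1) (gluingV sq2).
have [pE pEP] := set_map _ _ _ _ _ _ _ _ _ _ _ (gluingE sq1) (gluingE sq2).
have k2i := gluing_injr (gluingV sq2).
have p_src e : pV (src e) = src (pE e).
  by apply: k2i; rewrite pVP !hom_src pEP.
have p_tgt e : pV (tgt e) = tgt (pE e).
  by apply: k2i; rewrite pVP !hom_tgt pEP.
have p_elab e : elab e = elab (pE e).
  by rewrite (hom_elab k1) -pEP -hom_elab.
have p_vlab : lab_preserved (@vlab _ _ C1) (@vlab _ _ C2) pV.
  exact: (lab_preserved_complement (gluingV sq1) (gluingV sq2) pVP
    (@hom_vlab _ _ _ _ k1) (@hom_vlab _ _ _ _ k2) (@hom_vlab _ _ _ _ g1)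
    (@hom_vlab _ _ _ _ g2) rl (gluing_vlab sq2)).
have p_root : lab_preserved (@root _ _ C1) (@root _ _ C2) pV.
  exact: (lab_preserved_complement (gluingV sq1) (gluingV sq2) pVP
    (@hom_root _ _ _ _ k1) (@hom_root _ _ _ _ k2) (@hom_root _ _ _ _ g1)
    (@hom_root _ _ _ _ g2) rr (gluing_root sq2)).
by exists (Hom p_src p_tgt p_elab p_vlab p_root).
Qed.

(** All equations follow by cancelling the injective [k1] and [k2]. Compatibility with [g1] and [g2]
    is kept because [pushout_iso] needs an isomorphism of spans. *)
Lemma complement_iso (LV LE : finType) (A B C1 C2 P : graph LV LE)
    (f : hom A B) (h : hom B P) (g1 : hom A C1) (k1 : hom C1 P)
    (g2 : hom A C2) (k2 : hom C2 P) :
  gluing f g1 h k1 -> reflecting f g1 -> gluing f g2 h k2 -> reflecting f g2 ->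
  exists (phi : hom C1 C2) (psi : hom C2 C1),
    [/\ hom_eq (hom_comp psi phi) (hom_id C1),
        hom_eq (hom_comp phi psi) (hom_id C2),
        hom_eq (hom_comp phi g1) g2 & hom_eq (hom_comp psi g2) g1].
Proof.
move=> sq1 rf1 sq2 rf2.
have [phi [pV pE]] := complement_hom sq1 rf1 sq2.
have [psi [qV qE]] := complement_hom sq2 rf2 sq1.
have [i1V i1E] := (gluing_injr (gluingV sq1), gluing_injr (gluingE sq1)).
have [i2V i2E] := (gluing_injr (gluingV sq2), gluing_injr (gluingE sq2)).
exists phi, psi; split; split=> z.
- by apply: i1V; rewrite [LHS]qV [LHS]pV.
- by apply: i1E; rewrite [LHS]qE [LHS]pE.
- by apply: i2V; rewrite [LHS]pV [LHS]qV.
- by apply: i2E; rewrite [LHS]pE [LHS]qE.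
- by apply: i2V; rewrite [LHS]pV -(gluing_comm (gluingV sq1))
                         (gluing_comm (gluingV sq2)).
- by apply: i2E; rewrite [LHS]pE -(gluing_comm (gluingE sq1))
                         (gluing_comm (gluingE sq2)).
- by apply: i1V; rewrite [LHS]qV -(gluing_comm (gluingV sq2))
                         (gluing_comm (gluingV sq1)).
- by apply: i1E; rewrite [LHS]qE -(gluing_comm (gluingE sq2))
                         (gluing_comm (gluingE sq1)).
Qed.

Lemma pushout_hom (LV LE : finType) (A B C1 C2 P1 P2 : graph LV LE)
    (f : hom A B) (g1 : hom A C1) (h1 : hom B P1) (k1 : hom C1 P1)
    (g2 : hom A C2) (h2 : hom B P2) (k2 : hom C2 P2) (phi : hom C1 C2) :
  is_pushout f g1 h1 k1 -> commutes f g2 h2 k2 ->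
  hom_eq (hom_comp phi g1) g2 ->
  exists u : hom P1 P2, hom_eq (hom_comp u h1) h2 /\
                        hom_eq (hom_comp u k1) (hom_comp k2 phi).
Proof.
move=> [_ po] [cV cE] [pV pE].
have [|u [uP _]] := po P2 h2 (hom_comp k2 phi); last by exists u.
by split=> a; [rewrite [LHS]cV /= -pV | rewrite [LHS]cE /= -pE].
Qed.

Lemma pushout_iso (LV LE : finType) (A B C1 C2 P1 P2 : graph LV LE)
    (f : hom A B) (g1 : hom A C1) (h1 : hom B P1) (k1 : hom C1 P1)
    (g2 : hom A C2) (h2 : hom B P2) (k2 : hom C2 P2)
    (phi : hom C1 C2) (psi : hom C2 C1) :
  is_pushout f g1 h1 k1 -> is_pushout f g2 h2 k2 ->
  hom_eq (hom_comp psi phi) (hom_id C1) ->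
  hom_eq (hom_comp phi psi) (hom_id C2) ->
  hom_eq (hom_comp phi g1) g2 -> hom_eq (hom_comp psi g2) g1 -> iso P1 P2.
Proof.
move=> po1 po2 [e1V e1E] [e2V e2E] pg qg.
have [u [/hom_comp_eq[uhV uhE] /hom_comp_eq[ukV ukE]]] := pushout_hom po1 po2.1 pg.
have [w [/hom_comp_eq[whV whE] /hom_comp_eq[wkV wkE]]] := pushout_hom po2 po1.1 qg.
exists u, w; split.
  apply: (pushout_endo_id po1); split=> z /=.
  - by rewrite uhV whV.
  - by rewrite uhE whE.
  - by rewrite ukV wkV; congr (homV k1 _); apply: e1V.
  - by rewrite ukE wkE; congr (homE k1 _); apply: e1E.
apply: (pushout_endo_id po2); split=> z /=.
- by rewrite whV uhV.
- by rewrite whE uhE.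
- by rewrite wkV ukV; congr (homV k2 _); apply: e2V.
- by rewrite wkE ukE; congr (homE k2 _); apply: e2E.
Qed.

(** * Rule application *)

(** Points outside the image of [g] are never deleted, and a kept point [g l] forces [l] to come
    from [K]. The predicate [q] stands for both [deletedV] and [deletedE]. *)
Lemma set_gluing_kept (K L V : finType) (f : K -> L) (g : L -> V) (q : pred V)
    (d : K -> {v : V | ~~ q v}) :
  injective g -> (forall k, val (d k) = g (f k)) ->
  (forall v, q v = [exists x, (x \notin codom f) && (g x == v)]) ->
  set_gluing f d g val.
Proof.
move=> gi dP qE; split=> // [|v|l v glv].
- exact: val_inj.
- have [/codomP[l ->]|vL] := boolP (v \in codom g); first by left; exists l.
  have vq : ~~ q v.
    rewrite qE; apply/existsP=> -[x /andP[_ /eqP gx]].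
    by rewrite -gx codom_f in vL.
  by right; exists (exist _ v vq).
- have /codomP[a ea] : l \in codom f.
    apply: contraR (valP v) => lK; rewrite qE; apply/existsP.
    by exists l; rewrite lK glv eqxx.
  by exists a; split=> //; apply: val_inj; rewrite dP -ea glv.
Qed.

(** * Erasing labels at nodes of K and redefining them from R *)

Section UndefineLabels.
Variables (T : eqType) (K L R V : finType) (f : K -> L) (f' : K -> R).
Variables (g : L -> V) (q : pred V) (d : K -> {v : V | ~~ q v}).
Variables (lK : K -> option T) (lL : L -> option T) (lR : R -> option T).
Variable lG : V -> option T.

(* [lD] and [lH] are convertible to [vlab], and also to [root], of the
   intermediate and result graphs. *)
Let undef v := [pick k | (g (f k) == v) && (lK k == None)].
Let lD (v : {v : V | ~~ q v}) := if undef (val v) is Some _ then None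
                                 else lG (val v).
Let lH (v : {v : V | ~~ q v} + {x : R | x \notin codom f'}) :=
  match v with
  | inl v => if undef (val v) is Some k then lR (f' k) else lD v
  | inr x => lR (val x)
  end.

Hypotheses (f_inj : injective f) (g_inj : injective g).
Hypothesis f'_inj : injective f'.
Hypothesis dP : forall k, val (d k) = g (f k).
Hypotheses (pf : lab_preserved lK lL f) (pf' : lab_preserved lK lR f').
Hypothesis pg : lab_preserved lL lG g.
Hypothesis tL : forall x, isSome (lL x).

(** Injectivity of [g] and [f] leaves [k] as the only candidate for the choice. *)
Lemma undef_im k : undef (g (f k)) = if lK k == None then Some k else None.
Proof.
rewrite /undef; case: pickP => [k' /andP[/eqP/g_inj/f_inj -> ->] //|].
by move/(_ k); rewrite eqxx /= => ->.
Qed.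

Lemma undef_itf_preserved : lab_preserved lK lD d.
Proof.
move=> k lk; rewrite /lD dP undef_im; case: eqP lk => [-> //|_ lk].
by rewrite -pg // -pf.
Qed.

Lemma undef_preserved : lab_preserved lD lG val.
Proof. by move=> v; rewrite /lD; case: (undef _). Qed.

(** A label erased in [lD] sits at the image of a point of [L], and [lL] is total. *)
Lemma undef_covered : set_gluing f d g val -> lab_covered lL lD lG g val.
Proof.
move=> sq v lv; have [[b hb]|[c cv]] := gluing_cover sq v.
  by left; exists b.
case ec: (undef v) => [k|]; last by right; exists c; rewrite /lD cv ec.
move: ec; rewrite /undef; case: pickP => // k' /andP[/eqP gk _] _.
by left; exists (f k').
Qed.

(** Erasure leaves [d k] unlabelled whenever [k] is, whatever the other leg of the span; the
    statement therefore serves both squares. *)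
Lemma undef_reflected (B : Type) (lB : B -> option T) (fB : K -> B) :
  lab_reflected lK lB lD fB d.
Proof. by move=> k _; rewrite /lD dP undef_im; case: (lK k). Qed.

(** At a point of [K] without a label, [lH] reads [lR] by construction; at a labelled one, the kept
    value and [lR] both agree with [lK]. *)
Lemma redef_rhs_preserved : lab_preserved lR lH (glue_inl f' d).
Proof.
move=> b; case: glue_inlP => // [a|b'] -> // lb /=.
rewrite dP undef_im; case: eqP => // /eqP la; have {}la : isSome (lK a).
  by case: (lK a) la.
by rewrite -undef_itf_preserved // pf'.
Qed.

Lemma redef_preserved : lab_preserved lD lH inl.
Proof. by move=> v; rewrite /lH /lD; case: (undef _). Qed.

Lemma redef_covered : lab_covered lR lD lH (glue_inl f' d) inl.
Proof.
move=> [v|x] /=; last by left; exists (val x); rewrite glue_inl_new.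
case ev: (undef _) => [k|] lv; last by right; exists v.
left; exists (f' k); split=> //; rewrite glue_inl_im //; congr inl.
apply: val_inj; rewrite dP.
by move: ev; rewrite /undef; case: pickP => // k' /andP[/eqP gk _] [<-].
Qed.
End UndefineLabels.

Section RuleApplication.
Variables (LV LE : finType) (r : rule LV LE) (G : graph LV LE).
Variables (g : hom (lhs r) G) (gi : hom_inj g) (dc : dangling_condition g).

Lemma keptE_itf (k : edge (itf r)) :
  ~~ deletedE g (homE g (homE (incL r) k)).
Proof.
apply/existsP=> -[x /andP[xK /eqP /gi.2 xk]].
by move: xK; rewrite xk codom_f.
Qed.

Let D := intermediate gi dc.
Let H := result gi dc.

Let dV (k : vert (itf r)) : vert D :=
  exist _ (homV g (homV (incL r) k)) (keptV_itf gi k).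
Let dE (k : edge (itf r)) : edge D :=
  exist _ (homE g (homE (incL r) k)) (keptE_itf k).

Lemma application_squares :
  exists (d : hom (itf r) D) (c : hom D G) (c' : hom D H) (h : hom (rhs r) H),
    natural_double_pushout g d c c' h.
Proof.
have [[LiV LiE] [RiV RiE]] := (incL_inj r, incR_inj r).
have [[giV giE] [tLl tLr]] := (gi, lhs_TLRG r).
have dVi : injective dV by move=> k k' [] /giV/LiV.
have dEi : injective dE by move=> k k' [] /giE/LiE.
have Ll := @hom_vlab _ _ _ _ (incL r); have Lr := @hom_root _ _ _ _ (incL r).
have Rl := @hom_vlab _ _ _ _ (incR r); have Rr := @hom_root _ _ _ _ (incR r).
have gl := @hom_vlab _ _ _ _ g; have gr := @hom_root _ _ _ _ g.
have dVP k : val (dV k) = homV g (homV (incL r) k) by [].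
have d_src e : dV (src e) = src (dE e).
  by apply: val_inj; rewrite /= !hom_src.
have d_tgt e : dV (tgt e) = tgt (dE e).
  by apply: val_inj; rewrite /= !hom_tgt.
have d_elab e : elab e = elab (dE e) by rewrite /= -!hom_elab.
pose d := @Hom _ _ (itf r) D dV dE d_src d_tgt d_elab
  (undef_itf_preserved LiV giV dVP Ll gl tLl)
  (undef_itf_preserved LiV giV dVP Lr gr tLr).
have c_vlab : lab_preserved (@vlab _ _ D) (@vlab _ _ G) val.
  exact: undef_preserved.
have c_root : lab_preserved (@root _ _ D) (@root _ _ G) val.
  exact: undef_preserved.
pose c := @Hom _ _ D G val val (fun=> erefl) (fun=> erefl) (fun=> erefl)
  c_vlab c_root.
have c'_vlab : lab_preserved (@vlab _ _ D) (@vlab _ _ H) inl.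
  exact: redef_preserved.
have c'_root : lab_preserved (@root _ _ D) (@root _ _ H) inl.
  exact: redef_preserved.
pose c' := @Hom _ _ D H inl inl (fun=> erefl) (fun=> erefl) (fun=> erefl)
  c'_vlab c'_root.
(* This function is convertible to [result_node], so the incidence laws at new edges hold by
   computation. *)
pose hV : vert (rhs r) -> vert H := glue_inl (homV (incR r)) dV.
pose hE : edge (rhs r) -> edge H := glue_inl (homE (incR r)) dE.
have h_src e : hV (src e) = src (hE e).
  rewrite /hE; case: glue_inlP => // [a|e'] -> //.
  by rewrite -hom_src /hV glue_inl_im // d_src.
have h_tgt e : hV (tgt e) = tgt (hE e).
  rewrite /hE; case: glue_inlP => // [a|e'] -> //.
  by rewrite -hom_tgt /hV glue_inl_im // d_tgt.
have h_elab e : elab e = elab (hE e).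
  rewrite /hE; case: glue_inlP => // [a|e'] -> //.
  by rewrite -hom_elab d_elab.
pose h := @Hom _ _ (rhs r) H hV hE h_src h_tgt h_elab
  (redef_rhs_preserved LiV giV RiV dVP Ll Rl gl tLl)
  (redef_rhs_preserved LiV giV RiV dVP Lr Rr gr tLr).
have sqV : set_gluing (homV (incL r)) dV (homV g) val.
  exact: set_gluing_kept.
have sqE : set_gluing (homE (incL r)) dE (homE g) val.
  exact: set_gluing_kept.
exists d, c, c', h; split.
  apply/natural_pushoutP; [by split | by split | split].
    by split; [exact: sqV | exact: sqE | exact: undef_covered tLl sqV
            | exact: undef_covered tLr sqV].
  by split; apply: undef_reflected.
apply/natural_pushoutP; [by split | by split | split].
  by split; [apply: set_glueP | apply: set_glueP | apply: redef_covered
            | apply: redef_covered].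
by split; apply: undef_reflected.
Qed.
End RuleApplication.

(** * Consequences for natural double pushouts *)

Lemma natural_double_pushout_gluings (LV LE : finType) (r : rule LV LE)
    (G D H : graph LV LE) (g : hom (lhs r) G) (d : hom (itf r) D)
    (c : hom D G) (c' : hom D H) (h : hom (rhs r) H) :
  hom_inj g -> natural_double_pushout g d c c' h ->
  [/\ gluing (incL r) d g c, reflecting (incL r) d,
      gluing (incR r) d h c' & reflecting (incR r) d].
Proof.
move=> gi [np1 np2].
have di : hom_inj d := commutes_inj (incL_inj r) gi np1.1.1.
have [sq1 rf1] := (natural_pushoutP g c (incL_inj r) di).1 np1.
by have [sq2 rf2] := (natural_pushoutP h c' (incR_inj r) di).1 np2.
Qed.

(** An edge outside the match comes from [D], hence so do its endpoints. An endpoint that is also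
    the image of a node of [L] lies in the overlap, which puts that node in [K]. *)
Lemma natural_double_pushout_dangling (LV LE : finType) (r : rule LV LE)
    (G D H : graph LV LE) (g : hom (lhs r) G) (d : hom (itf r) D)
    (c : hom D G) (c' : hom D H) (h : hom (rhs r) H) :
  hom_inj g -> natural_double_pushout g d c c' h -> dangling_condition g.
Proof.
move=> gi /(natural_double_pushout_gluings gi)[sq _ _ _] e eL v vK.
have [[x gx]|[y <-]] := gluing_cover (gluingE sq) e.
  by rewrite -gx codom_f in eL.
rewrite -hom_src -hom_tgt.
by split=> /esym/(gluing_overlap (gluingV sq))[a [va _]];
   rewrite va codom_f in vK.
Qed.

Lemma natural_double_pushout_unique (LV LE : finType) (r : rule LV LE)
    (G D1 H1 D2 H2 : graph LV LE) (g : hom (lhs r) G)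
    (d1 : hom (itf r) D1) (c1 : hom D1 G) (c1' : hom D1 H1)
    (h1 : hom (rhs r) H1) (d2 : hom (itf r) D2) (c2 : hom D2 G)
    (c2' : hom D2 H2) (h2 : hom (rhs r) H2) :
  hom_inj g ->
  natural_double_pushout g d1 c1 c1' h1 ->
  natural_double_pushout g d2 c2 c2' h2 -> iso D1 D2 /\ iso H1 H2.
Proof.
move=> gi np1 np2.
have [sq1 rf1 _ _] := natural_double_pushout_gluings gi np1.
have [sq2 rf2 _ _] := natural_double_pushout_gluings gi np2.
have [phi [psi [e1 e2 pg qg]]] := complement_iso sq1 rf1 sq2 rf2.
split; first by exists phi, psi.
exact: pushout_iso np1.2.1 np2.2.1 e1 e2 pg qg.
Qed.

(** Both directions are the same transfer with the squares exchanged, using totality of [R] one way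
    and of [L] the other. *)
Lemma derives_TLRG (LV LE : finType) (r : rule LV LE) (G H : graph LV LE) :
  derives r G H -> (TLRG G <-> TLRG H).
Proof.
move=> [g [D [d [c [c' [h [gi np]]]]]]].
have [sq1 _ sq2 _] := natural_double_pushout_gluings gi np.
have [[tLl tLr] [tRl tRr]] := (lhs_TLRG r, rhs_TLRG r).
split=> -[tl tr]; split.
- exact: (lab_total_transfer (gluingV sq1) (gluingV sq2) (gluing_vlab sq1)
    (@hom_vlab _ _ _ _ h) (@hom_vlab _ _ _ _ c')).
- exact: (lab_total_transfer (gluingV sq1) (gluingV sq2) (gluing_root sq1)
    (@hom_root _ _ _ _ h) (@hom_root _ _ _ _ c')).
- exact: (lab_total_transfer (gluingV sq2) (gluingV sq1) (gluing_vlab sq2)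
    (@hom_vlab _ _ _ _ g) (@hom_vlab _ _ _ _ c)).
- exact: (lab_total_transfer (gluingV sq2) (gluingV sq1) (gluing_root sq2)
    (@hom_root _ _ _ _ g) (@hom_root _ _ _ _ c)).
Qed.

Theorem mainTheorem1 (LV LE : finType) (r : rule LV LE) :
  (forall (G : graph LV LE) (g : hom (lhs r) G) (gi : hom_inj g),
     ((exists (D H : graph LV LE) (d : hom (itf r) D) (c : hom D G)
              (c' : hom D H) (h : hom (rhs r) H),
         natural_double_pushout g d c c' h)
      <-> dangling_condition g)
     /\
     forall dc : dangling_condition g,
       (forall (D1 H1 : graph LV LE) (d1 : hom (itf r) D1) (c1 : hom D1 G)
               (c1' : hom D1 H1) (h1 : hom (rhs r) H1)
               (D2 H2 : graph LV LE) (d2 : hom (itf r) D2) (c2 : hom D2 G)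
               (c2' : hom D2 H2) (h2 : hom (rhs r) H2),
          natural_double_pushout g d1 c1 c1' h1 ->
          natural_double_pushout g d2 c2 c2' h2 ->
          iso D1 D2 /\ iso H1 H2)
       /\
       (TLRG G ->
        forall (D H : graph LV LE) (d : hom (itf r) D) (c : hom D G)
               (c' : hom D H) (h : hom (rhs r) H),
          natural_double_pushout g d c c' h ->
          iso D (intermediate gi dc) /\ iso H (result gi dc)))
  /\
  (forall G H : graph LV LE, derives r G H -> (TLRG G <-> TLRG H)).
Proof.
split=> [G g gi|]; last exact: derives_TLRG.
split=> [|dc].
  split=> [[D [H [d [c [c' [h np]]]]]]|dc].
    exact: natural_double_pushout_dangling np.
  have [d [c [c' [h np]]]] := application_squares gi dc.
  by exists (intermediate gi dc), (result gi dc), d, c, c', h.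
split=> [D1 H1 d1 c1 c1' h1 D2 H2 d2 c2 c2' h2|_ D H d c c' h np].
  exact: natural_double_pushout_unique.
(* The construction itself yields a natural double pushout, so uniqueness identifies any other with
   it. *)
have [d0 [c0 [c0' [h0 np0]]]] := application_squares gi dc.
exact: natural_double_pushout_unique np np0.
Qed.
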